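(* Every compactly generated totally disconnected locally compact group $G$ has an essentially chief series, i.e. a finite series $\{1\}=N_0\trianglelefteq N_1\trianglelefteq\dots\trianglelefteq N_n=G$ of closed normal subgroups of $G$ such that for each $1\le i\le n$ the quotient $N_i/N_{i-1}$ is compact, or discrete, or a chief factor of $G$ (meaning there is no closed normal subgroup $N\trianglelefteq G$ with $N_{i-1}\subsetneq N\subsetneq N_i$).
   Context: All $N_i$ are required to be closed and normal in $G$ itself (not merely in $N_{i+1}$); quotients carry the quotient topology. *)

(* Defs.v *)
From HB Require Import structures.
From mathcomp Require Import all_boot all_order all_algebra.
From mathcomp Require Import all_classical all_reals all_analysis.

Set Implicit Arguments.
Unset Strict Implicit.
Unset Printing Implicit Defensive.

Local Open Scope classical_set_scope.

Section TopGroup.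
Variable T : topologicalType.
Variables (mul : T -> T -> T) (inv : T -> T) (one : T).

Definition group_axioms : Prop :=
  [/\ forall x y z, mul x (mul y z) = mul (mul x y) z,
      forall x, mul one x = x /\ mul x one = x
    & forall x, mul (inv x) x = one /\ mul x (inv x) = one].

Definition topological_group : Prop :=
  [/\ group_axioms,
      continuous (fun p : T * T => mul p.1 p.2)
    & continuous inv].

Definition subgroup (H : set T) : Prop :=
  [/\ H one,
      forall x y, H x -> H y -> H (mul x y)
    & forall x, H x -> H (inv x)].

Definition normal_subgroup (N : set T) : Prop :=
  subgroup N /\ forall g x, N x -> N (mul (mul g x) (inv g)).

Definition closed_normal_subgroup (N : set T) : Prop :=
  normal_subgroup N /\ closed N.

Definition generated_subgroup (K : set T) : set T :=
  \bigcap_(H in [set H | subgroup H /\ K `<=` H]) H.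

Definition compactly_generated : Prop :=
  exists K : set T, compact K /\ generated_subgroup K = setT.

Definition tdlc : Prop :=
  [/\ hausdorff_space T, totally_disconnected [set: T]
    & locally_compact [set: T]].

(* ---- Quotient M / L (L <= M subgroups), with the quotient topology of
   the subspace topology of M.  Elements are the left cosets xL, x in M. *)
Variables (M L : set T).

Definition qpi (x : T) : set T := [set y | L (mul (inv x) y)].

Definition coset_set : set (set T) := [set A | exists2 x, M x & A = qpi x].

Definition quot_space : Type := set_type coset_set.

HB.instance Definition _ := Choice.on quot_space.

Definition qpre (U : set quot_space) : set T :=
  [set x | M x /\ exists2 u, U u & val u = qpi x].

Definition quot_open (U : set quot_space) : Prop :=
  exists2 O : set T, open O & qpre U = M `&` O.

Lemma quot_openT : quot_open setT.
Proof.
exists setT; first exact: openT.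
rewrite setIT; apply/seteqP; split=> x /=; first by case.
move=> Mx; split=> //.
have cx : qpi x \in coset_set by apply/mem_set; exists x.
by exists (SigSub cx).
Qed.

Lemma quot_openI : setI_closed quot_open.
Proof.
move=> A B [W1 oW1 e1] [W2 oW2 e2]; exists (W1 `&` W2); first exact: openI.
apply/seteqP; split=> x.
- move=> [Mx [u [Au Bu] ux]].
  have h1 : qpre A x by split=> //; exists u.
  have h2 : qpre B x by split=> //; exists u.
  rewrite e1 in h1; rewrite e2 in h2.
  by case: h1 => _ ?; case: h2 => _ ?.
- move=> [Mx [W1x W2x]].
  have : qpre A x by rewrite e1.
  have : qpre B x by rewrite e2.
  move=> [_ [v Bv vx]] [_ [u Au ux]]; split=> //; exists u => //.
  have -> : u = v by apply: val_inj; rewrite ux vx.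
  by split=> //; rewrite -(_ : u = v) //; apply: val_inj; rewrite ux vx.
Qed.

Lemma quot_op_bigU (I : Type) (f : I -> set quot_space) :
  (forall i, quot_open (f i)) -> quot_open (\bigcup_i f i).
Proof.
move=> hf.
pose good i W := open W /\ qpre (f i) = M `&` W.
exists (\bigcup_i \bigcup_(W in good i) W).
  by apply: bigcup_open => i _; apply: bigcup_open => W [].
apply/seteqP; split=> x.
- move=> [Mx [u [i _ fiu] ux]].
  have [W oW eW] := hf i.
  have : qpre (f i) x by split=> //; exists u.
  rewrite eW => -[_ Wx]; split=> //; exists i => //; exists W => //.
- move=> [Mx [i _ [W [oW eW] Wx]]].
  have : qpre (f i) x by rewrite eW.
  move=> [_ [u fiu ux]]; split=> //; exists u => //; by exists i.
Qed.

HB.instance Definition _ :=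
  isOpenTopological.Build quot_space quot_openT quot_openI quot_op_bigU.

End TopGroup.

Arguments quot_space {T} mul inv M L.

Definition essentially_chief_series (T : topologicalType)
  (mul : T -> T -> T) (inv : T -> T) (one : T)
  (n : nat) (N : nat -> set T) : Prop :=
  [/\ N 0%N = [set one],
      N n = [set: T],
      forall i, (i <= n)%N -> closed_normal_subgroup mul inv one (N i),
      forall i, (1 <= i <= n)%N -> N i.-1 `<=` N i
    & forall i, (1 <= i <= n)%N ->
        [\/ compact [set: quot_space mul inv (N i) (N i.-1)],
            (forall U : set (quot_space mul inv (N i) (N i.-1)), open U)
          | ~ exists K : set T,
                [/\ closed_normal_subgroup mul inv one K,
                    N i.-1 `<=` K, K `<=` N i, K != N i.-1 & K != N i]]].

(* Main.v *)
Require Import Defs.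
From HB Require Import structures.
From mathcomp Require Import all_boot all_order all_algebra.
From mathcomp Require Import all_classical all_reals all_analysis.

(** Let [U] be a compact open subgroup (van Dantzig) and [K] a compact generating
    set; finitely many cosets [g U], [g] in [L], cover all the [x^-1 U x] and
    [x U x^-1] with [x] in [K].  For [N] closed and normal, the number [rank N]
    of [g] in [L] that lie in [U N] is a bounded monotone function of [N].
    If [N <= M] have equal rank, then [W := M `&` U N] is normal in [G], and
    [W / N] is compact while [M / W] is discrete.  By compactness of [U] and
    openness of [U], the rank is continuous along decreasing intersections and
    increasing unions of chains, so Zorn's lemma applies at constant rank: given
    [N], let [C >= N] be maximal of the rank of [N], let [E > C] have the least
    possible rank, and let [D] be minimal of the rank of [E] with
    [C <= D <= E].  Then [D / C] is a chief factor, and the rank has increased. *)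

Set Implicit Arguments.
Unset Strict Implicit.
Unset Printing Implicit Defensive.

Local Open Scope classical_set_scope.

(** * Counting in lists, and compactness *)

(** Each entry counts at least as much for [b] as for [a], so equal totals force agreement entry by
    entry. This will turn equal ranks into equal sets. *)
Lemma count_eq_sub (T : eqType) (a b : pred T) (s : seq T) :
  subpred a b -> count a s = count b s -> forall x, x \in s -> b x -> a x.
Proof.
move=> ab; elim: s => //= y s IHs E x.
have les := sub_count ab s.
have [ay|nay] := boolP (a y).
  move: E; rewrite ay (ab _ ay) => -[E].
  by rewrite in_cons => /orP[/eqP->//|xs]; exact: IHs.
have nby : ~~ b y.
  apply/negP => yb; move: E les; rewrite (negbTE nay) yb add0n add1n => ->.
  by rewrite ltnn.
move: E; rewrite (negbTE nay) (negbTE nby) => E.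
by rewrite in_cons => /orP[/eqP->|xs]; [rewrite (negbTE nby)|exact: IHs].
Qed.

(** The traces of [F] on [C] are a base of a proper filter; a cluster point of it in [C] lies in
    every closed member of [F]. *)
Lemma compact_directed_closed (T : topologicalType) (C : set T)
    (F : set (set T)) :
  compact C -> F !=set0 ->
  (forall A B, F A -> F B -> exists2 D, F D & D `<=` A `&` B) ->
  (forall A, F A -> closed A) -> (forall A, F A -> C `&` A !=set0) ->
  exists2 x, C x & forall A, F A -> A x.
Proof.
move=> cC [A0 FA0] dirF clF meetF.
pose G := filter_from F (fun A => C `&` A).
have FG : Filter G.
  apply: filter_from_filter; first by exists A0.
  move=> A B FA FB; have [D FD sD] := dirF A B FA FB.
  by exists D => // x [Cx /sD[]].
have PG : ProperFilter G by exact: filter_from_proper.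
have GC : G C by exists A0 => // x [].
have [x [Cx clx]] := cC G PG GC; exists x => // A FA.
by apply: (clF A FA) => B xB; apply: clx => //; exists A => // y [].
Qed.

(** * Topological groups *)

Section TopologicalGroup.
Variables (T : topologicalType) (mul : T -> T -> T) (inv : T -> T) (one : T).
Hypothesis topG : topological_group mul inv one.

Local Notation "x * y" := (mul x y).
Local Notation "x ^-1" := (inv x).
Local Notation subgroup := (subgroup mul inv one).
Local Notation normal_subgroup := (normal_subgroup mul inv one).
Local Notation closed_normal := (closed_normal_subgroup mul inv one).

Let mulA x y z : x * (y * z) = (x * y) * z.
Proof. by have [[? _ _] _ _] := topG. Qed.
Let mul1 x : one * x = x.
Proof. by have [[_ /(_ x)[? _] _] _ _] := topG. Qed.
Let mulx1 x : x * one = x.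
Proof. by have [[_ /(_ x)[_ ?] _] _ _] := topG. Qed.
Let mulVx x : x^-1 * x = one.
Proof. by have [[_ _ /(_ x)[? _]] _ _] := topG. Qed.
Let mulxV x : x * x^-1 = one.
Proof. by have [[_ _ /(_ x)[_ ?]] _ _] := topG. Qed.
Let mulKx x y : x^-1 * (x * y) = y.
Proof. by rewrite mulA mulVx mul1. Qed.
Let mulVKx x y : x * (x^-1 * y) = y.
Proof. by rewrite mulA mulxV mul1. Qed.
Let mulI x y z : x * y = x * z -> y = z.
Proof. by move=> /(congr1 (mul x^-1)); rewrite !mulKx. Qed.
Let invK x : x^-1^-1 = x.
Proof. by apply: (@mulI x^-1); rewrite mulxV mulVx. Qed.
Let invM x y : (x * y)^-1 = y^-1 * x^-1.
Proof. by apply: (@mulI (x * y)); rewrite mulxV -mulA mulVKx mulxV. Qed.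
Let inv1 : one^-1 = one.
Proof. by rewrite -[LHS]mul1 mulxV. Qed.

(* A confluent rewrite system for the word problem in free groups. *)
Let groupE := (invM, invK, inv1, mulKx, mulVKx, mulVx, mulxV, mul1, mulx1,
  fun x y z : T => esym (mulA x y z)).

Let continuous_mul (S : topologicalType) (f g : S -> T) :
  continuous f -> continuous g -> continuous (fun s => f s * g s).
Proof.
have [_ cm _] := topG => cf cg s.
apply: (@continuous2_cvg S T T T (nbhs s) _ f g mul (f s) (g s)).
- exact: (cm (f s, g s)).
- exact: cf.
- exact: cg.
Qed.

Let continuous_inv (S : topologicalType) (f : S -> T) :
  continuous f -> continuous (fun s => (f s)^-1).
Proof.
by have [_ _ ci] := topG => cf s; apply: continuous_comp; [exact: cf|exact: ci].
Qed.

Let continuous_cst (S : topologicalType) (a : T) : continuous (fun _ : S => a).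
Proof. by move=> s; exact: cvg_cst. Qed.

Let continuous_idT : continuous (fun x : T => x).
Proof. by move=> x; exact: cvg_id. Qed.

Let continuous_fstT : continuous (fun p : T * T => p.1).
Proof. by move=> p; exact: cvg_fst. Qed.

Let continuous_sndT : continuous (fun p : T * T => p.2).
Proof. by move=> p; exact: cvg_snd. Qed.

Ltac cont := repeat first [exact: continuous_cst | exact: continuous_idT
  | exact: continuous_fstT | exact: continuous_sndT | apply: continuous_mul
  | apply: continuous_inv].

Lemma open_lcoset (O : set T) a : open O -> open [set x | O (a * x)].
Proof.
have /continuousP : continuous (fun x => a * x) by cont.
exact.
Qed.

Lemma subgroup_open (H O : set T) :
  subgroup H -> open O -> O one -> O `<=` H -> open H.
Proof.
move=> [H1 HM HV] oO O1 OH; rewrite openE => x Hx.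
rewrite /interior nbhsE /=; exists [set y | O (x^-1 * y)].
  by split; [exact: open_lcoset|rewrite /= mulVx].
by move=> y /OH/(HM _ _ Hx); rewrite mulVKx.
Qed.

Lemma open_subgroup_closed (H : set T) : subgroup H -> open H -> closed H.
Proof.
move=> [H1 HM HV] oH x /(_ [set y | H (x^-1 * y)]).
case.
  by apply: open_nbhs_nbhs; split; [exact: open_lcoset|rewrite /= mulVx].
by move=> y [Hy /HV] /(HM _ _ Hy); rewrite !groupE.
Qed.

Lemma closure_maps (f : T -> T) (A D : set T) :
  continuous f -> closed D -> (forall x, A x -> D (f x)) ->
  forall x, closure A x -> D (f x).
Proof.
move=> /continuous_closedP cf clD fA; have : closed (f @^-1` D) by exact: cf.
by move=> clfD x /(closureS fA) /clfD.
Qed.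

Lemma closure_normal (N : set T) : normal_subgroup N -> closed_normal (closure N).
Proof.
move=> [[N1 NM NV] NJ]; split; last exact: closed_closure.
have cl := @closed_closure T N; have sub := @subset_closure T N.
split; first split.
- exact: sub.
(* Membership in the closure is reduced to membership in [N] one factor at a time. *)
- move=> x y Nx; move: y; apply: closure_maps => // [|y Ny]; first by cont.
  move: x Nx; apply: (@closure_maps (fun x => x * y)) => // [|x Nx]; first by cont.
  exact/sub/NM.
- by apply: closure_maps => // [|x /NV/sub//]; cont.
- move=> g; apply: (@closure_maps (fun x => g * x * g^-1)) => //; first by cont.
  by move=> x /(NJ g)/sub.
Qed.

(* The product set U N, written so that compactness of U can be used on u. *)
Definition mulset (U N : set T) : set T :=
  [set x | exists2 u, U u & N (u^-1 * x)].

Lemma normalJV (N : set T) g x : normal_subgroup N -> N x -> N (g^-1 * (x * g)).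
Proof. by move=> [_ /(_ g^-1 x)] + Nx => /(_ Nx); rewrite !groupE. Qed.

Lemma subset_mulset_l (U N : set T) : N one -> U `<=` mulset U N.
Proof. by move=> N1 u Uu; exists u => //; rewrite mulVx. Qed.

Lemma subset_mulset_r (U N : set T) : U one -> N `<=` mulset U N.
Proof. by move=> U1 x Nx; exists one => //; rewrite !groupE. Qed.

Lemma mulsetS (U N M : set T) : N `<=` M -> mulset U N `<=` mulset U M.
Proof. by move=> NM x [u Uu /NM]; exists u. Qed.

Lemma mulset_subgroup (U N : set T) :
  subgroup U -> normal_subgroup N -> subgroup (mulset U N).
Proof.
move=> [U1 UM UV] nN; have [[N1 NM NV] NJ] := nN; split.
- by exists one => //; rewrite !groupE.
- move=> x y [u Uu Nux] [v Vv Nvy]; exists (u * v); first exact: UM.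
  have -> : (u * v)^-1 * (x * y) = v^-1 * ((u^-1 * x) * v) * (v^-1 * y).
    by rewrite !groupE.
  by apply: NM => //; exact: normalJV.
- move=> x [u Uu Nux]; exists u^-1; first exact: UV.
  by have /(NJ u) := NV _ Nux; rewrite !groupE.
Qed.

Lemma mulset_open (U N : set T) :
  subgroup U -> open U -> normal_subgroup N -> open (mulset U N).
Proof.
move=> sU oU nN; have [U1 _ _] := sU; have [[N1 _ _] _] := nN.
by apply: (subgroup_open (mulset_subgroup sU nN) oU U1); exact: subset_mulset_l.
Qed.

(** For [z] in the closure of [N], the open coset [U z] meets [N]. Hence taking closures will not
    change ranks. *)
Lemma mulset_closure (U N : set T) : subgroup U -> open U ->
  mulset U (closure N) `<=` mulset U N.
Proof.
move=> [U1 UM UV] oU x [u Uu]; set z := u^-1 * x => clz.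
have [|y [Ny Uzy]] := clz [set y | U (z * y^-1)].
  apply: open_nbhs_nbhs; split; last by rewrite /= mulxV.
  have /continuousP : continuous (fun y => z * y^-1) by cont.
  exact.
exists (u * (z * y^-1)); first exact: UM.
by rewrite /z !groupE.
Qed.

(** * Compact open subgroups *)

(** Continuity gives a neighbourhood of [one] for each [x] in [C]; the near-covering form of
    compactness makes it uniform in [x]. *)
Lemma compact_tube (C O : set T) : compact C -> open O -> C `<=` O ->
  exists W : set T, [/\ open W, W one & forall x w, C x -> W w -> O (x * w)].
Proof.
move=> cC oO CO.
have /compact_near_coveringP nC := cC.
have : nbhs one [set w | C `<=` (fun x => O (x * w))].
  apply: (nC T (nbhs one) (fun w x => O (x * w))) => x Cx.
  have /continuousP cm : continuous (fun p : T * T => p.1 * p.2) by cont.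
  have : nbhs (x, one) [set p : T * T | O (p.1 * p.2)].
    by apply: open_nbhs_nbhs; split; [exact: cm|rewrite /= mulx1; exact: CO].
  exact.
rewrite nbhsE => -[W [oW W1] sW]; exists W; split => // x w Cx Ww.
exact: sW.
Qed.

Lemma open_div_nbhs (W : set T) : open W -> W one ->
  exists V : set T, [/\ open V, V one & forall v w, V v -> V w -> W (v * w^-1)].
Proof.
move=> oW W1.
have /continuousP cm : continuous (fun p : T * T => p.1 * p.2^-1) by cont.
have : nbhs (one, one) [set p : T * T | W (p.1 * p.2^-1)].
  by apply: open_nbhs_nbhs; split; [exact: cm|rewrite /= !groupE].
move=> [[A B] /= [nA nB] AB]; exists (A° `&` B°); split.
- by apply: openI; exact: open_interior.
- by [].
- move=> v w [/interior_subset Av _] [_ /interior_subset Bw].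
  exact: (AB (v, w)).
Qed.

Lemma open_product (A W : set T) : open W ->
  open [set x | exists2 a, A a & W (a^-1 * x)].
Proof.
move=> oW.
rewrite (_ : [set _ | _] = \bigcup_(a in A) [set x | W (a^-1 * x)]) //.
by apply: bigcup_open => a _; exact: open_lcoset.
Qed.

(* The quasi-component of [one] in a compact neighbourhood [V] is connected,
   hence trivial. So the relatively clopen subsets of [V] that contain [one]
   cannot all meet the compact complement of the interior of [V]. *)
Lemma compact_open_nbhs : tdlc T ->
  exists C : set T, [/\ C one, open C & compact C].
Proof.
move=> [hT tdT /(_ one I)]; rewrite withinET => -[V V1 [cV clV]].
pose F := [set A | [/\ A `<=` V, A one, closed A & closed (V `\` A)]].
have FV : F V.
  by split => //; [exact: nbhs_singleton|rewrite setDv; exact: closed0].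
have FI A B : F A -> F B -> F (A `&` B).
  move=> [AV A1 clA clVA] [BV B1 clB clVB]; split => //.
  - by move=> x [/AV].
  - exact: closedI.
  - by rewrite setDIr; exact: closedU.
have dirF A B : F A -> F B -> exists2 D, F D & D `<=` A `&` B.
  by move=> FA FB; exists (A `&` B) => //; exact: FI.
(* Compactness in contrapositive form: if each point of [D] is avoided by some member of [F], then
   one member avoids all of [D]. *)
have escape (D : set T) : closed D -> D `<=` V ->
    (forall x, D x -> exists2 A, F A & ~ A x) ->
    exists2 A, F A & A `&` D = set0.
  move=> clD DV Desc; apply: contrapT => noA.
  have [|A FA|A FA|x Dx allA] :=
      compact_directed_closed (subclosed_compact clD cV DV) _ dirF (F := F).
  - by exists V.
  - by case: FA.
  - apply/set0P/eqP => DA; apply: noA; exists A => //.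
    by rewrite setIC.
  - by have [A /allA] := Desc x Dx.
pose Q := \bigcap_(A in F) A.
have Q1 : Q one by move=> A [].
have QV : Q `<=` V by move=> x /(_ V FV).
have clQ : closed Q by apply: closed_bigI => A [].
(* A separation of [Q] into [E b], containing [one], and [E (~~ b)] is thickened to disjoint open
   sets [P b] and [P (~~ b)]. Some [A] in [F] lies in their union; its part in [P b] is again in
   [F], yet misses [E (~~ b)]. *)
have conQ : connected Q.
  apply: contrapT => /connectedPn [E [E0 QE [sep1 sep2]]].
  have clE b : closed (E b).
    move=> x clx; have : Q x.
      apply: clQ; apply: closureS clx; rewrite QE.
      by case: b => y; [right|left].
    rewrite QE => -[] Ex; case: b clx => // clx.
    - have : (E false `&` closure (E true)) x by [].
      by rewrite sep2.
    - have : (closure (E false) `&` E true) x by [].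
      by rewrite sep1.
  have EQ b : E b `<=` Q by rewrite QE; case: b => x ?; [right|left].
  have [b Eb1] : exists b, E b one.
    by move: Q1; rewrite QE => -[]; [exists false|exists true].
  have disj : E b `<=` ~` E (~~ b).
    move=> x Ebx Enbx; case: b Ebx Enbx {Eb1} => /= Ex Ex'.
    - have : (E false `&` closure (E true)) x by split => //; exact: subset_closure.
      by rewrite sep2.
    - have : (E false `&` closure (E true)) x by split => //; exact: subset_closure.
      by rewrite sep2.
  have cEb : compact (E b).
    by apply: (subclosed_compact (clE b) cV) => x /EQ/QV.
  have [W [oW W1 tubeW]] := compact_tube cEb (closed_openC (clE (~~ b))) disj.
  have [W' [oW' W'1 divW']] := open_div_nbhs oW W1.
  pose P b := [set x | exists2 a, E b a & W' (a^-1 * x)].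
  have oP c : open (P c) by exact: open_product.
  have EP c : E c `<=` P c by move=> x Ex; exists x; rewrite ?mulVx.
  have PP x : P b x -> ~ P (~~ b) x.
    move=> [a Ea Wax] [c Ec Wcx]; apply: (tubeW _ _ Ea (divW' _ _ Wax Wcx)).
    by rewrite !groupE.
  have [||x [Vx nP]|A [AV A1 clA clVA] AP] :=
      escape (V `&` (~` P b `&` ~` P (~~ b))).
  - by apply: closedI => //; apply: closedI; exact: open_closedC.
  - by move=> x [].
  - apply: contrapT => noA; have : Q x.
      by move=> A FA; apply: contrapT => nAx; apply: noA; exists A.
    rewrite QE => Ex; case: nP => nPb nPnb.
    case: b {Eb1 disj cEb tubeW PP} nPb nPnb => /= nP nP'.
    + by case: Ex => /EP.
    + by case: Ex => /EP.
  have FAP : F (A `&` P b).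
    split.
    - by move=> x [/AV].
    - by split => //; exact: EP.
    - rewrite (_ : A `&` P b = A `&` ~` P (~~ b)).
        by apply: closedI => //; exact: open_closedC.
      apply/seteqP; split => x [Ax Px]; split => //; first exact: PP.
      apply: contrapT => nPx; have : (A `&` (V `&` (~` P b `&` ~` P (~~ b)))) x.
        by split => //; split => //; exact: AV.
      by rewrite AP.
    - rewrite setDIr; apply: closedU => //; rewrite setDE.
      by apply: closedI => //; exact: open_closedC.
  have [x Ex] := E0 (~~ b).
  have [_ Px] := EQ _ _ Ex _ FAP.
  by apply: (PP x Px); exact: EP.
have Q_one : Q `<=` [set one].
  rewrite -(tdT one Logic.I) => x Qx.
  exact: (@connected_component_max _ _ Q).
have [||x [Vx nVx]|A [AV A1 clA clVA] AV0] := escape (V `&` ~` V°).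
- by apply: closedI => //; apply: open_closedC; exact: open_interior.
- by move=> x [].
- apply: contrapT => noA; have /Q_one x1 : Q x.
    by move=> A FA; apply: contrapT => nAx; apply: noA; exists A.
  by apply: nVx; rewrite x1.
have AVo : A `<=` V°.
  move=> x Ax; apply: contrapT => nVx.
  have : (A `&` (V `&` ~` V°)) x by split => //; split => //; exact: AV.
  by rewrite AV0.
exists A; split => //; last exact: subclosed_compact clA cV AV.
rewrite (_ : A = V° `&` ~` (V `\` A)).
  by apply: openI; [exact: open_interior|exact: closed_openC].
apply/seteqP; split => x.
  by move=> Ax; split; [exact: AVo|case].
move=> [/interior_subset Vx nVA]; apply: contrapT => nAx; exact: nVA.
Qed.

(** [U] is the stabilizer of [C] under right translation. It lies in [C] because [one] does, and it
    is open by the tube lemma for [C] inside itself. *)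
Lemma compact_open_subgroup : tdlc T ->
  exists U : set T, [/\ subgroup U, open U & compact U].
Proof.
move=> /compact_open_nbhs [C [C1 oC cC]].
pose U := [set g | forall c, C c -> C (c * g) /\ C (c * g^-1)].
have sU : subgroup U.
  split.
  - by move=> c; rewrite inv1 mulx1.
  - move=> x y Ux Uy c Cc; have [Cx _] := Ux c Cc; have [Cxy _] := Uy _ Cx.
    have [_ Cy] := Uy c Cc; have [_ Cyx] := Ux _ Cy.
    by rewrite invM !mulA.
  - by move=> x Ux c /Ux []; rewrite invK.
have [W [oW W1 tubeW]] := compact_tube cC oC (@subset_refl _ C).
have oU : open U.
  apply: (subgroup_open sU (O := W `&` [set x | W x^-1])).
  - apply: openI => //; have /continuousP : continuous (fun y => y^-1) by cont.
    exact.
  - by rewrite /= inv1.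
  - by move=> g [Wg WVg] c Cc; split; exact: tubeW.
exists U; split => //; apply: (subclosed_compact _ cC).
  exact: open_subgroup_closed.
by move=> g /(_ one C1); rewrite mul1 => -[].
Qed.

Lemma compact_finite_lcosets (U Y : set T) : subgroup U -> open U -> compact Y ->
  exists L : seq T, forall y, Y y -> exists2 g, g \in L & U (g^-1 * y).
Proof.
move=> [U1 UM UV] oU /compact_near_coveringP nY.
(* Lists ordered by inclusion of their entries carry a filter; near-covering along it yields one
   list that serves all of [Y]. *)
pose B (s : seq T) := [set t : seq T | {subset s <= t}].
pose F := filter_from setT B.
have FF : Filter F.
  apply: filter_from_filter; first by exists [::].
  move=> s t _ _; exists (s ++ t) => // r sr.
  by split => x xs; apply: sr; rewrite mem_cat xs ?orbT.
have : F [set s | Y `<=` (fun y => exists2 g, g \in s & U (g^-1 * y))].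
  apply: (nY _ F (fun s y => exists2 g, g \in s & U (g^-1 * y))) => x Yx.
  exists ([set y | U (x^-1 * y)], B [:: x]).
    split; last by exists [:: x].
    by apply: open_nbhs_nbhs; split; [exact: open_lcoset|rewrite /= mulVx].
  move=> [y s] /= [Uy sx]; exists x => //.
  by apply: sx; rewrite mem_head.
by move=> [s _ /(_ s)] sY; exists s; apply: sY.
Qed.

(** * Compact and discrete quotients *)

Lemma qpi_eq (L : set T) x y : subgroup L -> L (x^-1 * y) ->
  qpi mul inv L x = qpi mul inv L y.
Proof.
move=> [_ LM LV] Lxy; apply/seteqP; split => z /= Lz.
- by have := LM _ _ (LV _ Lxy) Lz; rewrite !groupE.
- by have := LM _ _ Lxy Lz; rewrite !groupE.
Qed.

(** The quotient is the continuous image of [C], which meets every coset. *)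
Lemma quot_compact (M L C : set T) : M one -> subgroup L -> compact C ->
  C `<=` M -> (forall x, M x -> exists2 c, C c & L (c^-1 * x)) ->
  compact [set: quot_space mul inv M L].
Proof.
move=> M1 sL cC CM MC.
have class x : M x -> exists q : quot_space mul inv M L,
    val q = qpi mul inv L x.
  move=> Mx; have cx : qpi mul inv L x \in coset_set mul inv M L.
    by apply/mem_set; exists x.
  by exists (SigSub cx).
(* [f] is the quotient map on [M], with an unspecified value elsewhere; the class of [one] shows
   that such a value exists. *)
have /choice[f fE] : forall x, exists q : quot_space mul inv M L,
    M x -> val q = qpi mul inv L x.
  move=> x.
  have [/class[q qx]|nMx] := pselect (M x); first by exists q.
  by have [q _] := class _ M1; exists q.
have -> : [set: quot_space mul inv M L] = f @` C.
  apply/seteqP; split => // q _.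
  have /set_mem[x Mx qx] := valP q; have [c Cc Lcx] := MC x Mx.
  exists c => //; apply: val_inj; rewrite fE; last exact: CM.
  by rewrite [RHS]qx; exact: qpi_eq.
apply: continuous_compact => //; apply/subspace_continuousP => x Cx A.
rewrite nbhsE => -[V [[B oB VB] Vfx] VA].
have preV y : M y -> qpre V y <-> V (f y).
  move=> My; split => [[_ [q Vq qy]]|Vfy].
    by rewrite (_ : f y = q) //; apply: val_inj; rewrite fE.
  by split => //; exists (f y) => //; exact: fE.
have Bx : B x by have := (preV _ (CM _ Cx)).2 Vfx; rewrite VB => -[].
rewrite /= nbhs_filterE /within /=.
apply: filterS (open_nbhs_nbhs (conj oB Bx)) => y By Cy; apply: VA.
apply/preV; first exact: CM.
by rewrite VB; split => //; exact: CM.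
Qed.

(** The points of [M] in a translate [x O], with [x] in [M], lie in [x L]; so the preimage of any
    set of cosets is the trace on [M] of a union of open translates. *)
Lemma quot_discrete (M L O : set T) : subgroup M -> subgroup L ->
  open O -> O one -> M `&` O `<=` L ->
  forall V : set (quot_space mul inv M L), open V.
Proof.
move=> [_ MM MV] sL oO O1 MOL V.
exists [set y | exists2 x, qpre V x & O (x^-1 * y)]; first exact: open_product.
apply/seteqP; split => [x Vx|y [My [x [Mx [q Vq qx]] Oxy]]].
  by split; [case: Vx|exists x; rewrite ?mulVx].
split => //; exists q => //; rewrite qx; apply: qpi_eq => //.
by apply: MOL; split => //; apply: MM => //; exact: MV.
Qed.

(** * Series with good factors *)

Definition good_factor (A B : set T) : Prop :=
  [\/ compact [set: quot_space mul inv B A],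
      (forall V : set (quot_space mul inv B A), open V)
    | ~ exists D : set T,
          [/\ closed_normal D, A `<=` D, D `<=` B, D != A & D != B]].

(** The bottom term is arbitrary, so that a series can be built by prepending factors. *)
Definition series_from (A : set T) : Prop :=
  exists n (N : nat -> set T),
    [/\ N 0%N = A, N n = setT,
        forall i, (i <= n)%N -> closed_normal (N i),
        forall i, (1 <= i <= n)%N -> N i.-1 `<=` N i
      & forall i, (1 <= i <= n)%N -> good_factor (N i.-1) (N i)].

Lemma series_from_cons (A B : set T) : closed_normal A -> A `<=` B ->
  good_factor A B -> series_from B -> series_from A.
Proof.
move=> nA AB gAB [n [N [N0 Nn nN NS gN]]].
exists n.+1, (fun i => if i is j.+1 then N j else A); split => //.
- by case=> [|i] //; exact: nN.
- by case=> [|[|i]] // lein; [rewrite N0|exact: (NS i.+1)].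
- by case=> [|[|i]] // lein; [rewrite N0|exact: (gN i.+1)].
Qed.

(** * Ranks of closed normal subgroups *)

Section Rank.
Variables (U K : set T) (L : seq T).
Hypotheses (sU : subgroup U) (oU : open U) (cU : compact U).
Hypothesis genK : generated_subgroup mul inv one K = setT.
Hypothesis coverL : forall x u, K x -> U u ->
  (exists2 g, g \in L & U (g^-1 * (x^-1 * (u * x)))) /\
  (exists2 g, g \in L & U (g^-1 * (x * (u * x^-1)))).

(* Plays the role of minus the degree of the quotient by [N] of the
   Cayley-Abels graph on [G / U]. *)
Definition rank (N : set T) : nat := count (fun g => `[< mulset U N g >]) L.

Lemma rankS (N M : set T) : N `<=` M -> (rank N <= rank M)%N.
Proof.
by move=> NM; apply: sub_count => g /= /asboolP /(mulsetS NM) /asboolP.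
Qed.

Lemma rank_eqP (N M : set T) : N `<=` M ->
  rank N = rank M <-> (forall g, g \in L -> mulset U M g -> mulset U N g).
Proof.
move=> NM; split => [rNM g gL /asboolP Mg|MN].
  apply/asboolP; apply: (count_eq_sub _ rNM gL Mg) => h /= /asboolP.
  by move=> /(mulsetS NM) /asboolP.
apply: eq_in_count => g gL; apply/asboolP/asboolP; first exact: mulsetS.
exact: MN.
Qed.

Lemma generated_ind (H : set T) : subgroup H -> K `<=` H -> forall g, H g.
Proof.
move=> sH KH g; have : generated_subgroup mul inv one K g by rewrite genK.
by apply.
Qed.

(** [U N] is a union of left cosets of [U], so membership can be tested on the representatives in
    [L]. *)
Lemma mulset_lcoset (N : set T) g y : normal_subgroup N -> U (g^-1 * y) ->
  mulset U N g <-> mulset U N y.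
Proof.
move=> nN Ugy; have [_ PM PV] := mulset_subgroup sU nN.
have Pgy : mulset U N (g^-1 * y).
  by apply: subset_mulset_l => //; case: nN => -[].
split => [Pg|Py]; first by have := PM _ _ Pg Pgy; rewrite !groupE.
by have := PM _ _ Py (PV _ Pgy); rewrite !groupE.
Qed.

(* If [m = u n] lies in [M `&` U N] and [x] in [K], then [x^-1 u x] lies in [M];
   since it is in a coset [g U] with [g] in [L], it also lies in [U N]. *)
Lemma normal_core (N M : set T) : closed_normal N -> closed_normal M ->
  N `<=` M -> rank N = rank M -> closed_normal (M `&` mulset U N).
Proof.
move=> [nN clN] [nM clM] NM /(rank_eqP NM) rNM.
have sP := mulset_subgroup sU nN; have [P1 PM PV] := sP.
have [[M1 MM MV] MJ] := nM; have [U1 _ _] := sU.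
set W := M `&` mulset U N.
have key x : (forall u, U u ->
      exists2 g, g \in L & U (g^-1 * (x^-1 * (u * x)))) ->
    forall m, W m -> W (x^-1 * (m * x)).
  move=> cov m [Mm [u Uu Num]]; split; first exact: normalJV.
  have Mu : M u by have := MM _ _ Mm (MV _ (NM _ Num)); rewrite !groupE.
  have -> : x^-1 * (m * x) = x^-1 * (u * x) * (x^-1 * (u^-1 * m * x)).
    by rewrite !groupE.
  apply: PM; last by apply: subset_mulset_r => //; exact: normalJV.
  have [g gL Ug] := cov u Uu; apply/(mulset_lcoset nN Ug)/rNM => //.
  apply/(mulset_lcoset nM Ug)/subset_mulset_r => //; exact: normalJV.
(* Recording both directions of conjugation makes [H] closed under inverses, hence a subgroup, and
   it suffices that it contains [K]. *)
pose H := [set x | forall m, W m -> W (x^-1 * (m * x)) /\ W (x * (m * x^-1))].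
have HT : forall x, H x.
  apply: generated_ind.
    split.
    - by move=> m Wm; rewrite !groupE.
    - move=> x y Hx Hy m Wm; split.
        by have [/Hy[+ _] _] := Hx m Wm; rewrite !groupE.
      by have [_ /Hx[_]] := Hy m Wm; rewrite !groupE.
    - by move=> x Hx m /Hx []; rewrite invK.
  move=> x Kx m Wm; split.
    by apply: key Wm => u Uu; have [] := coverL Kx Uu.
  have := key x^-1 _ m Wm; rewrite invK; apply => u Uu.
  by have [_] := coverL Kx Uu.
split; last first.
  apply: closedI => //; apply: open_subgroup_closed => //; exact: mulset_open.
split; first split.
- by [].
- by move=> x y [Mx Px] [My Py]; split; [exact: MM|exact: PM].
- by move=> x [Mx Px]; split; [exact: MV|exact: PV].
- by move=> g x Wx; have [_] := HT g x Wx; rewrite mulA.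
Qed.

(** The normal core [W] is inserted: [W / N] is the image of the compact intersection of [U] and
    [M], and [M / W] is discrete because the open set [U N] meets [M] exactly in [W]. *)
Lemma series_from_same_rank (N M : set T) : closed_normal N ->
  closed_normal M -> N `<=` M -> rank N = rank M ->
  series_from M -> series_from N.
Proof.
move=> cN cM NM rNM; have cW := normal_core cN cM NM rNM.
have [[sN _] _] := cN; have [[sM _] _] := cM; have [[sW _] _] := cW.
have [N1 _ _] := sN; have [M1 MM MV] := sM; have [U1 _ _] := sU.
move=> serM; apply: (series_from_cons (B := M `&` mulset U N)) => //.
- by move=> x Nx; split; [exact: NM|exact: subset_mulset_r].
- apply: Or31; apply: (quot_compact (C := U `&` M)) => //.
  + by case: sW.
  + by apply: compact_closedI => //; case: cM.
  + by move=> x [Ux Mx]; split => //; exact: subset_mulset_l.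
  + move=> x [Mx [u Uu Nux]]; exists u => //; split => //.
    by have := MM _ _ Mx (MV _ (NM _ Nux)); rewrite !groupE.
apply: series_from_cons serM => //.
apply: Or32; apply: (quot_discrete (O := mulset U N)) => //.
- by apply: mulset_open => //; case: cN.
- exact: subset_mulset_l.
Qed.

(** * Extremal subgroups of constant rank *)

(** A union of closed subgroups need not be closed, so Zorn's lemma runs over all normal subgroups
    and the closure is taken at the end. Rank survives unions of chains because a witness for the
    union is a witness for one member. *)
Lemma maximal_same_rank (N : set T) : closed_normal N ->
  exists C, [/\ closed_normal C, N `<=` C, rank N = rank C
    & forall D, closed_normal D -> C `<=` D -> rank C = rank D -> D `<=` C].
Proof.
move=> [nN clN]; have [[N1 _ _] _] := nN.
(* Zorn's lemma also asks for the empty chain, whence the unions with [N]. *)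
pose P X := normal_subgroup (N `|` X) /\
  forall g, g \in L -> mulset U (N `|` X) g -> mulset U N g.
have P0 : P set0 by rewrite /P setU0.
have [F FP totF|A [[nA rA] maxA]] := @Zorn_bigcup T P.
  rewrite /P; set Z := N `|` _.
  have pick x y : Z x -> Z y -> exists X,
      [/\ P X, N `|` X `<=` Z, (N `|` X) x & (N `|` X) y].
    have sZ X : F X -> N `|` X `<=` Z.
      by move=> FX z [Nz|Xz]; [left|right; exists X].
    move=> [Nx|[X FX Xx]] [Ny|[Y FY Yy]].
    - by exists set0; rewrite setU0; split=> // z; left.
    - by exists Y; split; [exact: FP|exact: sZ|left|right].
    - by exists X; split; [exact: FP|exact: sZ|right|left].
    - have [XY|YX] := totF X Y FX FY.
        by exists Y; split; [exact: FP|exact: sZ|right; exact: XY|right].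
      by exists X; split; [exact: FP|exact: sZ|right|right; exact: YX].
  split; first split; first split.
  - by left.
  - move=> x y Zx Zy; have [X [[[[_ XM _] _] _] XZ Xx Xy]] := pick x y Zx Zy.
    by apply: XZ; exact: XM.
  - move=> x Zx; have [X [[[[_ _ XV] _] _] XZ Xx _]] := pick x x Zx Zx.
    by apply: XZ; exact: XV.
  - move=> g x Zx; have [X [[[_ XJ] _] XZ Xx _]] := pick x x Zx Zx.
    by apply: XZ; exact: XJ.
  move=> g gL [u Uu Zug]; have [X [[_ rX] _ Xug _]] := pick _ _ Zug Zug.
  by apply: rX => //; exists u.
have NC : N `<=` closure (N `|` A).
  by move=> x Nx; apply: subset_closure; left.
have rNC : rank N = rank (closure (N `|` A)).
  apply/rank_eqP => // g gL /(mulset_closure sU oU); exact: rA.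
exists (closure (N `|` A)); split => //; first exact: closure_normal.
move=> D [nD _] CD; rewrite -rNC => /rank_eqP rD.
have ND : N `<=` D by exact: subset_trans CD.
have DA : D `<=` A.
  apply: contrapT => nDA; apply: (maxA D).
    by split => // x Ax; apply/CD/subset_closure; right.
  by rewrite /P (setUidr ND); split => //; exact: rD.
by move=> x /DA Ax; apply: subset_closure; right.
Qed.

(** Zorn's lemma is used for unions, so the variable [X] is the set removed from [E]: enlarging [X]
    shrinks the subgroup. *)
Lemma minimal_same_rank (C E : set T) : closed_normal C -> closed_normal E ->
  C `<=` E ->
  exists D, [/\ closed_normal D, C `<=` D, D `<=` E, rank D = rank E
    & forall D', closed_normal D' -> C `<=` D' -> D' `<=` D ->
        rank D' = rank E -> D `<=` D'].
Proof.
move=> cC cE CE.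
pose P X := [/\ closed_normal (E `\` X), C `<=` E `\` X &
  forall g, g \in L -> mulset U E g -> mulset U (E `\` X) g].
have [F FP totF|A [[cA CA rA] maxA]] := @Zorn_bigcup T P.
  have ZE : E `\` \bigcup_(X in F) X = E `&` \bigcap_(X in F) (E `\` X).
    apply/seteqP; split => [x [Ex nFx]|x [Ex Fx]]; split => //.
      by move=> X FX; split => // Xx; apply: nFx; exists X.
    by move=> [X FX Xx]; have [] := Fx X FX.
  have [[[E1 EM EV] EJ] clE] := cE.
  rewrite /P ZE; split.
  - split; last first.
      by apply: closedI => //; apply: closed_bigI => X /FP[[]].
    split; first split.
    + by split => // X /FP[[[[]]]].
    + move=> x y [Ex Fx] [Ey Fy]; split; first exact: EM.
      move=> X FX; have [[[[_ XM _] _] _] _ _] := FP X FX.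
      by apply: XM; [exact: Fx|exact: Fy].
    + move=> x [Ex Fx]; split; first exact: EV.
      move=> X FX; have [[[[_ _ XV] _] _] _ _] := FP X FX.
      by apply: XV; exact: Fx.
    + move=> g x [Ex Fx]; split; first exact: EJ.
      move=> X FX; have [[[_ XJ] _] _ _] := FP X FX.
      by apply: XJ; exact: Fx.
  - by move=> x Cx; split; [exact: CE|move=> X /FP[_ + _]; exact].
  - move=> g gL Eg; have [F0|] := pselect (F !=set0); last first.
      move=> nF; case: Eg => u Uu Eug; exists u => //; split => // X FX.
      by case: nF; exists X.
    (* The [u] that witness [g] for the various [X] form closed sets, directed along the chain, that
       all meet the compact [U]; a common [u] witnesses [g] for the intersection. *)
    pose fib X := [set u | (E `\` X) (u^-1 * g)].
    have [||_ [X FX <-]|_ [X FX <-]|u Uu Fu] :=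
        compact_directed_closed (F := fib @` F) cU.
    + by case: F0 => X FX; exists (fib X); exists X.
    + move=> _ _ [X FX <-] [Y FY <-]; have [XY|YX] := totF X Y FX FY.
        exists (fib Y); first by exists Y.
        by move=> u [Eu nYu]; split => //; split => // /XY.
      exists (fib X); first by exists X.
      by move=> u [Eu nXu]; split => //; split => // /YX.
    + have /continuous_closedP : continuous (fun u => u^-1 * g) by cont.
      by apply; have [[]] := FP X FX.
    + by have [_ _ /(_ g gL Eg)[u Uu Xu]] := FP X FX; exists u.
    + exists u => //; split.
        by case: F0 => X FX; have [] := Fu _ (ex_intro2 _ _ X FX erefl).
      by move=> X FX; exact: (Fu _ (ex_intro2 _ _ X FX erefl)).
exists (E `\` A); split => //.
  by apply/rank_eqP => // x [].
move=> D' cD' CD' D'D rD'.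
have D'E : D' `<=` E by move=> x /D'D [].
(* The competitor [D'] arises by removing its whole complement. *)
have ED' : E `\` ~` D' = D' by rewrite setDE setCK; exact: setIidr.
have sA : ~` D' `<=` A.
  apply: contrapT => nsA; apply: (maxA (~` D')).
    by split => // x Ax /D'D [].
  by rewrite /P ED'; split => //; exact/rank_eqP.
by move=> x [Ex nAx]; apply: contrapT => /sA.
Qed.

(** * Construction of the series *)

(** Induction on the gap between the rank and its bound [size L]; passing from [N] through [C] to
    [D] narrows it strictly. *)
Lemma series_from_closed_normal (N : set T) : closed_normal N -> series_from N.
Proof.
have [k] := ubnP (size L - rank N)%N.
elim: k N => // k IHk N; rewrite ltnS => leNk cN.
have [C [cC NC rNC maxC]] := maximal_same_rank cN.
apply: (series_from_same_rank cN cC NC rNC).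
have [->|CnT] := eqVneq C setT.
  exists 0%N, (fun=> setT); split => //; by case.
pose above r := `[< exists E,
  [/\ closed_normal E, C `<=` E, E != C & rank E = r] >].
have exE : exists r, above r.
  exists (rank setT); apply/asboolP; exists setT.
  by split=> //; rewrite eq_sym.
case: (ex_minnP exE) => r /asboolP [E [cE CE EC rE]] minr.
have [D [cD CD DE rD minD]] := minimal_same_rank cC cE CE.
have rC_lt D' : closed_normal D' -> C `<=` D' -> D' != C -> (rank C < rank D')%N.
  move=> cD' CD' nD'C; rewrite ltn_neqAle rankS // andbT.
  apply: contra nD'C => /eqP rCD'; apply/eqP/seteqP; split => //.
  exact: maxC.
have rCE := rC_lt E cE CE EC.
apply: (series_from_cons cC CD).
  (* Being strictly above [C], [D'] has at least the rank of [E]; being inside [D], it has at most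
     that rank. Minimality of [D] then gives [D' = D]. *)
  apply: Or33 => -[D' [cD' CD' D'D nD'C nD'D]].
  move/eqP: nD'D; apply; apply/seteqP; split => //.
  apply: minD => //; apply/eqP; rewrite eqn_leq (rankS (subset_trans D'D DE)) /=.
  by rewrite rE; apply: minr; apply/asboolP; exists D'.
apply: IHk => //; rewrite rD; apply: leq_trans leNk.
rewrite rNC; apply: ltn_sub2l => //; exact: leq_trans rCE (count_size _ _).
Qed.

End Rank.

Lemma essentially_chief_series_exists : tdlc T ->
  compactly_generated mul inv one ->
  exists n N, essentially_chief_series mul inv one n N.
Proof.
move=> tdlcT [K [cK genK]]; have [hT _ _] := tdlcT.
have [U [sU oU cU]] := compact_open_subgroup tdlcT.
have cpt (f : T * T -> T) : continuous f -> compact (f @` (K `*` U)).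
  move=> cf; apply: continuous_compact; last exact: compact_setX.
  exact: continuous_subspaceT.
(* [L] comes from the compact set of all conjugates of elements of [U] by elements of [K] and by
   their inverses. *)
have cY := compactU (cpt (fun p => p.1^-1 * (p.2 * p.1)) ltac:(cont))
  (cpt (fun p => p.1 * (p.2 * p.1^-1)) ltac:(cont)).
have [L coverL] := compact_finite_lcosets sU oU cY.
have n1 : closed_normal [set one].
  split; last by apply: compact_closed => //; exact: compact_set1.
  split; first split => //.
  - by move=> x y -> ->; rewrite mul1.
  - by move=> x ->; rewrite inv1.
  - by move=> g x ->; rewrite /= !groupE.
have [|n [N [N0 Nn nN NS gN]]] :=
  series_from_closed_normal sU oU cU genK _ n1 (L := L).
  by move=> x u Kx Uu; split; apply: coverL; [left|right]; exists (x, u).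
by exists n, N; split.
Qed.

End TopologicalGroup.

Theorem mainTheorem15 (T : topologicalType)
  (mul : T -> T -> T) (inv : T -> T) (one : T) :
  topological_group mul inv one ->
  tdlc T ->
  compactly_generated mul inv one ->
  exists (n : nat) (N : nat -> set T),
    essentially_chief_series mul inv one n N.
Proof. exact: essentially_chief_series_exists. Qed.
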